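(* Let $F$ be a field of characteristic $p>0$. Let $G$ be a locally pro-$p$ group which admits a profinite (i.e. compact) open subgroup $K$ such that the pair $(G,K)$ is fair, i.e. for every open subgroup $H\subset K$ there exists an open subgroup $H'\subsetneq H$ such that for all $g\in G$ the inclusion $$K\cap gH'g^{-1}\subsetneq K\cap gHg^{-1}$$ is strict. Then the category $\mathrm{Mod}_F(G)$ of smooth $F[G]$-modules has no nonzero projective objects.
   Context: A topological group $G$ is locally pro-$p$ if it has an open subgroup which is a pro-$p$ group in the induced topology (in particular $G$ is Hausdorff). A representation of $G$ on an $F$-vector space $V$ is smooth if every $v\in V$ has open stabilizer in $G$. $\mathrm{Mod}_F(G)$ is the abelian category of smooth $G$-representations on $F$-vector spaces, with $G$-equivariant $F$-linear maps as morphisms. Projective means projective in this abelian category. *)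

(* Defs.v *)
From HB Require Import structures.
From mathcomp Require Import all_boot all_order all_algebra.
From mathcomp Require Import all_classical.
From mathcomp Require Import topology.

Set Implicit Arguments.
Unset Strict Implicit.
Unset Printing Implicit Defensive.

Import GRing.Theory.
Local Open Scope classical_set_scope.
Local Open Scope group_scope.

(* No separation axiom is built in. *)
HB.mixin Record isTopologicalGroup G & Group G & Topological G := {
  mulg_continuous : continuous (fun x : G * G => x.1 * x.2);
  invg_continuous : continuous (fun x : G => x^-1)
}.

#[short(type="topologicalGroupType")]
HB.structure Definition TopologicalGroup :=
  {G of isTopologicalGroup G & Group G & Topological G}.

Section Subgroups.
Variable G : topologicalGroupType.
Implicit Types (U N H K : set G) (g : G).

Definition is_subgroup H : Prop := group_closed (mem H).

Definition open_subgroup H : Prop := is_subgroup H /\ open H.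

(* g H g^-1; note that [H :^ g] would be g^-1 H g. *)
Definition conj_set g H : set G := [set g * x * g^-1 | x in H].

Definition normal_in N U : Prop :=
  N `<=` U /\ forall g, U g -> conj_set g N = N.

Definition left_cosets U N : set (set G) :=
  [set [set g * x | x in N] | g in U].

(* Topological notions are relative to the topology induced by G on U:
   [compact] and [totally_disconnected] are already relative to the set, and
   the points outside U are isolated in [subspace U], so they do not affect
   the Hausdorff property. *)
Definition profinite U : Prop :=
  [/\ is_subgroup U, compact U, hausdorff_space (subspace U)
    & totally_disconnected U].

Definition pro_p (p : nat) U : Prop :=
  profinite U /\
  forall N, is_subgroup N -> normal_in N U -> open (N : set (subspace U)) ->
    exists n, (left_cosets U N #= `I_(p ^ n))%card.

Definition fair K : Prop :=
  forall H, open_subgroup H -> H `<=` K ->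
    exists H', [/\ open_subgroup H', H' `<` H
      & forall g, K `&` conj_set g H' `<` K `&` conj_set g H].

End Subgroups.

Definition locally_pro_p (p : nat) (G : topologicalGroupType) : Prop :=
  exists U : set G, open_subgroup U /\ pro_p p U.

Section SmoothRepresentations.
Variables (F : fieldType) (G : topologicalGroupType).

Record smooth_rep := SmoothRep {
  rep_space :> lmodType F;
  rep_act : G -> {linear rep_space -> rep_space};
  rep_act1 : forall v, rep_act 1 v = v;
  rep_actM : forall g h v, rep_act (g * h) v = rep_act g (rep_act h v);
  rep_smooth : forall v, open [set g | rep_act g v = v]
}.

Record rep_hom (V W : smooth_rep) := RepHom {
  rep_hom_fun :> {linear V -> W};
  rep_hom_equivariant :
    forall g v, rep_hom_fun (rep_act V g v) = rep_act W g (rep_hom_fun v)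
}.

Definition epimorphism (V W : smooth_rep) (e : rep_hom V W) : Prop :=
  forall (X : smooth_rep) (h1 h2 : rep_hom W X),
    h1 \o e =1 h2 \o e -> h1 =1 h2.

Definition projective (P : smooth_rep) : Prop :=
  forall (V W : smooth_rep) (e : rep_hom V W) (f : rep_hom P W),
    epimorphism e -> exists h : rep_hom P V, e \o h =1 f.

Definition nonzero (V : smooth_rep) : Prop := exists v : V, v <> 0%R.

End SmoothRepresentations.

(* Main.v *)
(* Let P be projective and v in P. The union of coset spaces G/H_w (w in P),
   with H_w stabilizing w, maps equivariantly to P by g H_w |-> g w, so the
   free module V on it covers P, and the cover splits; v lifts to an element f
   of V fixed by U := Stab(v) `&` U0, where U0 is open pro-p. Grouping the
   support of f into classes of points that are conjugate under U and have the
   same image in P, f contributes to v the size of each class times a vector.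
   The class of g H_w is a transitive set of the subgroup U `&` Stab(g w) of
   U0, so its size is a power of p, and it is not 1 as soon as U contains an
   element of g (Stab(w) `&` K) g^-1 outside g H_w g^-1. Fairness, iterated
   more than [K : K `&` U] times, yields such an H_w that works for all g at
   once. Hence v = 0. *)
Require Import Defs.
From HB Require Import structures.
From mathcomp Require Import all_boot all_order all_algebra.
From mathcomp Require Import finmap.
From mathcomp Require Import all_classical.
From mathcomp Require Import topology.

Set Implicit Arguments.
Unset Strict Implicit.
Unset Printing Implicit Defensive.

Import GRing.Theory.
Local Open Scope classical_set_scope.
Local Open Scope group_scope.

(** The fibers of [h] over its image partition [A]; the hypothesis, stated at points of [A], covers
    exactly the nonempty ones. *)
Lemma card_fset_fibers (I J : choiceType) (h : I -> J) (A : {fset I}) (k : nat) :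
  (forall i, i \in A -> #|` [fset x in A | h x == h i]%fset| = k) ->
  #|` A| = (k * #|` [fset h x | x in A]%fset|)%N.
Proof.
move=> hk; rewrite card_fset_sum1 (partition_big_imfset _ h) /=.
rewrite mulnC [X in _ = (X * _)%N]card_fset_sum1 big_distrl /=.
rewrite big_seq_cond [RHS]big_seq_cond; apply: eq_bigr => j.
rewrite andbT => /imfsetP[i /= iA ->].
by rewrite mul1n -(hk _ iA) card_fset_sum1 big_fset.
Qed.

(** * Subgroups, conjugates and cosets in a topological group *)

Section Cosets.
Variable G : topologicalGroupType.
Implicit Types (H K U N A B : set G) (g x y : G).

Definition lcoset g H : set G := [set g * x | x in H].

Lemma subgroup1 H : is_subgroup H -> H 1.
Proof. by case; rewrite inE. Qed.

Lemma subgroupVM H x y : is_subgroup H -> H x -> H y -> H (x^-1 * y).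
Proof.
move=> sH Hx Hy; have /(_ x^-1 y) := group_closedM sH.
rewrite !inE; apply => //; have /(_ x) := group_closedV sH.
by rewrite !inE; apply.
Qed.

Lemma subgroupV H x : is_subgroup H -> H x -> H x^-1.
Proof. by move=> sH Hx; rewrite -[x^-1]mulg1; apply: subgroupVM => //; apply: subgroup1.
Qed.

Lemma subgroupM H x y : is_subgroup H -> H x -> H y -> H (x * y).
Proof. by move=> sH Hx Hy; rewrite -[x]invgK; apply: subgroupVM => //; apply: subgroupV.
Qed.

Lemma is_subgroup_VM H :
  H 1 -> (forall x y, H x -> H y -> H (x^-1 * y)) -> is_subgroup H.
Proof.
move=> H1 HVM; split; first by rewrite inE.
have HV x : H x -> H x^-1 by move=> Hx; rewrite -[x^-1]mulg1; apply: HVM.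
move=> x y; rewrite !inE => Hx Hy.
by rewrite -[x]invgK; apply: HVM; apply: HV.
Qed.

Lemma is_subgroupI H K : is_subgroup H -> is_subgroup K -> is_subgroup (H `&` K).
Proof.
move=> sH sK; apply: is_subgroup_VM; first by split; apply: subgroup1.
by move=> x y [? ?] [? ?]; split; apply: subgroupVM.
Qed.

Lemma conj_setE g H : conj_set g H = [set x | H (g^-1 * x * g)].
Proof.
apply/seteqP; split=> x /=.
  by case=> y Hy <-; rewrite !mulgA mulVg mul1g -mulgA mulVg mulg1.
move=> Hx; exists (g^-1 * x * g) => //.
by rewrite !mulgA mulgV mul1g -mulgA mulgV mulg1.
Qed.

Lemma conj_setS g A B : A `<=` B -> conj_set g A `<=` conj_set g B.
Proof. by move=> AB x [y Ay <-]; exists y => //; apply: AB. Qed.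

Lemma is_subgroup_conj g H : is_subgroup H -> is_subgroup (conj_set g H).
Proof.
move=> sH; rewrite conj_setE; apply: is_subgroup_VM => /=.
  by rewrite mulg1 mulVg; apply: subgroup1.
move=> x y Hx Hy; have := subgroupVM sH Hx Hy.
by rewrite !invgM !invgK !mulgA -(mulgA _ g) mulgV mulg1.
Qed.

Lemma lcosetP g H x : lcoset g H x <-> H (g^-1 * x).
Proof.
split; first by case=> y Hy <-; rewrite mulgA mulVg mul1g.
by move=> Hx; exists (g^-1 * x) => //; rewrite mulgA mulgV mul1g.
Qed.

Lemma lcoset_refl g H : is_subgroup H -> lcoset g H g.
Proof. by move=> sH; apply/lcosetP; rewrite mulVg; apply: subgroup1. Qed.

Lemma lcoset_eq g h H : is_subgroup H -> (lcoset g H = lcoset h H) <-> H (g^-1 * h).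
Proof.
move=> sH; split=> [e|Hgh].
  by apply/lcosetP; rewrite e; apply: lcoset_refl.
apply/seteqP; split=> x /lcosetP Hx; apply/lcosetP.
  by have := subgroupVM sH Hgh Hx;
    rewrite invgM invgK !mulgA -(mulgA _ g) mulgV mulg1.
by have := subgroupM sH Hgh Hx; rewrite !mulgA -(mulgA _ h) mulgV mulg1.
Qed.

Lemma lcosetM g h H : lcoset (g * h) H = lcoset g (lcoset h H).
Proof.
apply/seteqP; split=> x.
  by case=> y Hy <-; exists (h * y); [exists y|rewrite mulgA].
by case=> _ [y Hy <-] <-; exists y; rewrite ?mulgA.
Qed.

Lemma lcoset1 H : lcoset 1 H = H.
Proof.
by apply/seteqP; split=> x; [case=> y Hy <-|exists x]; rewrite ?mul1g.
Qed.

Lemma lmul_continuous g : continuous (fun x => g * x).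
Proof.
move=> x; apply: (@continuous2_cvg _ _ _ _ _ _ _ _ (fun a b : G => a * b)).
- exact: (@mulg_continuous G (g, x)).
- exact: cvg_cst.
- exact: cvg_id.
Qed.

Lemma rmul_continuous g : continuous (fun x => x * g).
Proof.
move=> x; apply: (@continuous2_cvg _ _ _ _ _ _ _ _ (fun a b : G => a * b)).
- exact: (@mulg_continuous G (x, g)).
- exact: cvg_id.
- exact: cvg_cst.
Qed.

Lemma open_lcoset g H : open H -> open (lcoset g H).
Proof.
move=> oH; have -> : lcoset g H = (fun x => g^-1 * x) @^-1` H.
  by apply/seteqP; split=> x /lcosetP.
by apply: open_comp => // y _; apply: lmul_continuous.
Qed.

Lemma open_conj g H : open H -> open (conj_set g H).
Proof.
move=> oH; rewrite conj_setE.
apply: (@open_comp _ _ (fun x => g^-1 * x) [set x | H (x * g)]).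
  by move=> x _; apply: lmul_continuous.
by apply: open_comp => // x _; apply: rmul_continuous.
Qed.

Lemma open_subgroup_conj g H : open_subgroup H -> open_subgroup (conj_set g H).
Proof. by case=> ? ?; split; [apply: is_subgroup_conj|apply: open_conj]. Qed.

Lemma open_subgroupI H K : open_subgroup H -> open_subgroup K ->
  open_subgroup (H `&` K).
Proof. by case=> ? ? [? ?]; split; [apply: is_subgroupI|apply: openI]. Qed.

(** [S] is the union of the open cosets [x H] with [x] in [S]. *)
Lemma open_rstable H S : open_subgroup H ->
  (forall x h, S x -> H h -> S (x * h)) -> open S.
Proof.
move=> [sH oH] SH; rewrite (_ : S = \bigcup_(x in S) lcoset x H).
  by apply: bigcup_open => x _; apply: open_lcoset.
apply/seteqP; split=> x; first by move=> Sx; exists x => //; apply: lcoset_refl.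
by case=> y Sy [h Hh <-]; apply: SH.
Qed.

(** The open cosets [g U] with [g] in [K] cover the compact set [K]; cosets that meet are equal, so
    a finite subcover lists them all. *)
Lemma finite_left_cosets K U : compact K -> open_subgroup U ->
  finite_set (left_cosets K U).
Proof.
move=> cK [sU oU].
(* Compactness by open covers is phrased for pointed spaces; the base point [1] is an arbitrary
   choice. *)
pose G' : ptopologicalType := HB.pack (TopologicalGroup.sort G)
  (isPointed.Build (TopologicalGroup.sort G) 1).
have : cover_compact (K : set G') by rewrite -compact_cover.
move=> /(_ G K (fun g => lcoset g U)) [].
- by move=> g _; apply: open_lcoset.
- by move=> x Kx; exists x => //; apply: lcoset_refl.
move=> D DK KD;
apply: (sub_finite_set _ (finite_image (fun g => lcoset g U) (finite_fset D))).
move=> _ [g Kg <-]; have [d /= Dd gd] := KD _ Kg.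
by exists d => //; apply/lcoset_eq => //; apply/lcosetP.
Qed.

End Cosets.

Lemma open_finite_bigcap (T : topologicalType) (I : choiceType) (D : set I)
    (f : I -> set T) :
  finite_set D -> (forall i, D i -> open (f i)) -> open (\bigcap_(i in D) f i).
Proof.
move=> /finite_fsetP[X ->] fo; rewrite openE => x fx.
by apply: filter_bigI => i Xi; apply: open_nbhs_nbhs; split; [apply: fo|apply: fx].
Qed.

(** * Orbits and stabilizers of an abstract action *)

Section Action.
Variables (G : topologicalGroupType) (X : choiceType) (act : G -> X -> X).
Hypothesis act1 : forall x, act 1 x = x.
Hypothesis actM : forall g h x, act (g * h) x = act g (act h x).
Implicit Types (A H : set G) (g : G) (x : X).

Definition stabilizer x : set G := [set g | act g x = x].

Lemma is_subgroup_stabilizer x : is_subgroup (stabilizer x).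
Proof.
apply: is_subgroup_VM; first exact: act1.
move=> g h; rewrite /stabilizer /= => gx hx.
by rewrite actM hx -{1}gx -actM mulVg act1.
Qed.

Lemma stabilizer_act g x : stabilizer (act g x) = conj_set g (stabilizer x).
Proof.
rewrite conj_setE; apply/seteqP; split=> h; rewrite /stabilizer /= => e.
  by rewrite !actM e -actM mulVg act1.
by rewrite -{2}e -!actM !mulgA mulgV mul1g.
Qed.

(** Orbit-stabilizer: the coset [a S] corresponds to the point [act a x], as [S] is the stabilizer
    of [x] in [A]. *)
Lemma orbit_cosets A x (S := A `&` stabilizer x) : is_subgroup A ->
  finite_set (left_cosets A S) ->
  finite_set [set act a x | a in A] /\
  #|` fset_set [set act a x | a in A]| = #|` fset_set (left_cosets A S)|.
Proof.
move=> sA fin; have sS : is_subgroup S.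
  by apply: is_subgroupI => //; apply: is_subgroup_stabilizer.
(* Elements of [S] fix [x], so the element chosen in a coset is immaterial; cosets are nonempty, so
   the default [1] is never reached on them. *)
pose k (C : set G) := act (xget 1 C) x.
have kE a : A a -> k (lcoset a S) = act a x.
  move=> Aa; rewrite /k; case: xgetP => [b -> /lcosetP[_ bs]|/(_ a)]; last first.
    by case; apply: lcoset_refl.
  by rewrite -{2}bs -actM mulgA mulgV mul1g.
have imE : [set act a x | a in A] = k @` left_cosets A S.
  apply/seteqP; split=> y.
    by case=> a Aa <-; exists (lcoset a S); [exists a|rewrite kE].
  by case=> _ [a Aa <-] <-; exists a => //; rewrite -kE.
have finO : finite_set [set act a x | a in A] by rewrite imE; apply: finite_image.
split=> //.
rewrite -(@card_in_imfset imfset_key _ _ k (mem (fset_set (left_cosets A S)))).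
  congr #|` _|; apply/fsetP => y; rewrite in_fset_set // imE.
  apply/idP/imfsetP => /=.
    by rewrite inE => -[C AC <-]; exists C => //=; rewrite in_fset_set // inE.
  by case=> C; rewrite /= in_fset_set // inE => AC ->; rewrite inE; exists C.
move=> C D; rewrite /= !in_fset_set // !inE => -[a Aa <-] [b Ab <-].
rewrite -!/(lcoset _ _) !kE // => ab; apply/lcoset_eq => //; split.
  exact: subgroupVM.
by rewrite /stabilizer /= actM -ab -actM mulVg act1.
Qed.

End Action.

(** * Indices of subgroups and their divisibility in pro-p groups *)

Section Index.
Variable G : topologicalGroupType.
Implicit Types (H K U N A B X Y Z : set G) (g x y : G).

Definition coset_index X Y := #|` fset_set (left_cosets X Y)|.


(** The map from [X/Z] onto [X/Y] sending [g Z] to [g Y] has translates of [Y/Z] as fibers, all of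
    the same size. *)
Lemma index_mult X Y Z : is_subgroup X -> is_subgroup Y -> is_subgroup Z ->
  Z `<=` Y -> Y `<=` X -> finite_set (left_cosets X Z) ->
  coset_index X Z = (coset_index Y Z * coset_index X Y)%N.
Proof.
move=> sX sY sZ ZY YX fin.
(* The product set [C Y] defines this map without choosing a representative of [C]. *)
pose h (C : set G) := [set c * y | c in C & y in Y].
have hE g : h (lcoset g Z) = lcoset g Y.
  apply/seteqP; split=> x.
    by case=> _ [z Zz <-] [y Yy <-]; exists (z * y);
      [apply: subgroupM => //; apply: ZY|rewrite mulgA].
  by case=> y Yy <-; exists g; [exact: lcoset_refl|exists y].
have im : left_cosets X Y = h @` left_cosets X Z.
  apply/seteqP; split=> C.
    by case=> g Xg <-; exists (lcoset g Z); [exists g|apply: hE].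
  by case=> _ [g Xg <-] <-; exists g => //; apply/esym/hE.
have finXY : finite_set (left_cosets X Y) by rewrite im; apply: finite_image.
have finYZ : finite_set (left_cosets Y Z).
  by apply: sub_finite_set fin => C [g Yg <-]; exists g => //; apply: YX.
have -> : coset_index X Y = #|` [fset h C | C in fset_set (left_cosets X Z)]%fset|.
  congr #|` _|; apply/fsetP => C; rewrite in_fset_set // im.
  apply/idP/imfsetP => /=.
    by rewrite inE => -[D XD <-]; exists D => //=; rewrite in_fset_set // inE.
  by case=> D; rewrite /= in_fset_set // inE => XD ->; rewrite inE; exists D.
apply: card_fset_fibers => C0; rewrite in_fset_set // inE => -[g Xg <-].
(* Left multiplication by [g] carries [Y/Z] bijectively onto the fiber over [g Y]. *)
rewrite /coset_index -(@card_imfset imfset_key _ _ (lcoset g)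
  (mem (fset_set (left_cosets Y Z)))) /=; last first.
  by apply: (@can_inj _ _ _ (lcoset g^-1)) => C; rewrite -lcosetM mulVg lcoset1.
congr #|` _|; apply/fsetP => C; rewrite !inE /= in_fset_set //.
apply/andP/imfsetP => /=.
  rewrite inE => -[[x Xx <-] /eqP]; rewrite -!/(lcoset _ _) !hE => xg.
  exists (lcoset (g^-1 * x) Z); last by rewrite -lcosetM mulgA mulgV mul1g.
  rewrite in_fset_set // inE; exists (g^-1 * x) => //.
  by apply/lcoset_eq.
case=> D; rewrite in_fset_set // inE => -[y Yy <-] ->.
rewrite -!/(lcoset _ _) -lcosetM inE; split.
  by exists (g * y) => //; apply: subgroupM => //; apply: YX.
by apply/eqP; rewrite !hE; apply/lcoset_eq; rewrite // invgM -mulgA mulVg mulg1;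
  apply: subgroupV.
Qed.

Lemma index_gt1 A B a : is_subgroup A -> is_subgroup B ->
  finite_set (left_cosets A B) -> A a -> ~ B a -> (1 < coset_index A B)%N.
Proof.
move=> sA sB fin Aa Ba.
have ne : B <> lcoset a B.
  by rewrite -{1}(lcoset1 B) => /lcoset_eq-/(_ sB); rewrite invg1 mul1g.
have := @fsubset_leq_card _ [fset B; lcoset a B]%fset (fset_set (left_cosets A B)).
rewrite cardfs2 (introN eqP ne); apply.
apply/fsubsetP => C; rewrite !inE in_fset_set // inE.
case/orP=> /eqP->; last by exists a.
by exists 1; [exact: subgroup1|exact: lcoset1].
Qed.

(** The core is the kernel of the action of [U] on [U/B], an intersection of conjugates of [B].
    Compactness makes [U/B] finite, so the core is open. *)
Lemma open_normal_core U B : is_subgroup U -> compact U -> open_subgroup B ->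
  B `<=` U -> exists N, [/\ open_subgroup N, N `<=` B & normal_in N U].
Proof.
move=> sU cU oB BU; have [sB _] := oB.
pose N : set G := \bigcap_(C in left_cosets U B) stabilizer (@lcoset G) C.
have NE n : N n <-> forall u, U u -> B (u^-1 * n * u).
  split=> [Nn u Uu|Nn _ [u Uu <-]].
    have /esym := Nn (lcoset u B) (imageP _ Uu); rewrite -lcosetM.
    by move/lcoset_eq; rewrite mulgA; apply.
  rewrite -!/(lcoset _ _) /stabilizer /= -lcosetM; apply/esym/lcoset_eq => //.
  by rewrite mulgA; apply: Nn.
have sN : is_subgroup N.
  apply: is_subgroup_VM; first by move=> C _; apply: lcoset1.
  move=> x y Nx Ny C UC.
  exact: (subgroupVM (is_subgroup_stabilizer (@lcoset1 G) (@lcosetM G) C)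
    (Nx C UC) (Ny C UC)).
have NB : N `<=` B.
  by move=> n /NE/(_ 1 (subgroup1 sU)); rewrite invg1 mul1g mulg1.
exists N; split => //.
  split=> //; apply: open_finite_bigcap; first exact: finite_left_cosets.
  move=> _ [u Uu <-]; rewrite -/(lcoset _ _).
  rewrite (_ : stabilizer _ _ = conj_set u B); first by apply: open_conj; case: oB.
  rewrite conj_setE; apply/seteqP; split=> x; rewrite /stabilizer /= -lcosetM.
    by move/esym/lcoset_eq; rewrite mulgA; apply.
  by move=> Bx; apply/esym/lcoset_eq; rewrite ?mulgA.
split; first exact: subset_trans NB BU.
have NJ g n : U g -> N n -> N (g^-1 * n * g).
  move=> Ug /NE Nn; apply/NE => u Uu; have := Nn _ (subgroupM sU Ug Uu).
  by rewrite invgM !mulgA.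
move=> g Ug; rewrite conj_setE; apply/seteqP; split=> n /=; last exact: NJ.
move/(NJ _ _ (subgroupV sU Ug)); rewrite invgK !mulgA mulgV mul1g.
by rewrite -mulgA mulgV mulg1.
Qed.

(** For an open normal subgroup [N] of [U] inside [B], the index of [N] in [U] is a power of [p] and
    a multiple of that of [B] in [A]. The latter is thus a power of [p], and [a] excludes the value
    1. *)
Lemma pro_p_index p U A B a : prime p -> pro_p p U -> is_subgroup A ->
  A `<=` U -> open_subgroup B -> B `<=` A -> A a -> ~ B a ->
  finite_set (left_cosets A B) /\ (p %| coset_index A B)%N.
Proof.
move=> pp [[sU cU _ _] Up] sA AU oB BA Aa Ba.
have BU := subset_trans BA AU.
have [N [[sN oN] NB nN]] := open_normal_core sU cU oB BU.
have [n cn] := Up N sN nN (open_subspaceW oN).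
have finU : finite_set (left_cosets U N) by apply/finite_setP; exists (p ^ n)%N.
have finA : finite_set (left_cosets A N).
  by apply: sub_finite_set finU => C [g Ag <-]; exists g => //; apply: AU.
have finAB : finite_set (left_cosets A B).
  apply: sub_finite_set (finite_left_cosets cU oB) => C [g Ag <-].
  by exists g => //; apply: AU.
have [sB _] := oB; split=> //.
have : (coset_index A B %| p ^ n)%N.
  have /esym : coset_index U N = (p ^ n)%N by apply: card_fset_set.
  rewrite (index_mult sU sA sN (subset_trans NB BA) AU finU).
  rewrite (index_mult sA sB sN NB BA finA) => ->.
  by rewrite dvdn_mulr // dvdn_mull.
case/(dvdn_pfactor _ _ pp) => -[|m] _ e; last by rewrite e expnS dvdn_mulr.
by have := index_gt1 sA sB finAB Aa Ba; rewrite e.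
Qed.

End Index.

(* Along a fair chain H_0 > H_1 > ..., elements a_i of K `&` g H_i g^-1 outside
   g H_(i+1) g^-1 lie in distinct cosets of U as long as the intersections of
   U with the conjugates g H_i g^-1 stay constant, and K/U is finite. *)
Lemma fair_inside (G : topologicalGroupType) (K U H : set G) :
  is_subgroup K -> compact K -> fair K -> open_subgroup U ->
  open_subgroup H -> H `<=` K ->
  exists H', [/\ open_subgroup H', H' `<=` H
    & forall g, exists a, [/\ U a, conj_set g H a & ~ conj_set g H' a]].
Proof.
move=> sK cK fK oU oH HK; have [sU _] := oU.
(* [f] selects a fair shrinking of each open subgroup contained in [K]; elsewhere its value is
   arbitrary. *)
have /choice[f fP] : forall L, exists L', open_subgroup L -> L `<=` K ->
    [/\ open_subgroup L', L' `<` L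
      & forall g, K `&` conj_set g L' `<` K `&` conj_set g L].
  move=> L; have [[oL LK]|nL] := pselect (open_subgroup L /\ L `<=` K).
    by have [L' ?] := fK L oL LK; exists L'.
  by exists L => oL LK; case: nL.
pose Hs n := iter n f H.
have HsP n : open_subgroup (Hs n) /\ Hs n `<=` K.
  elim: n => // n [oHn HnK]; have [? [HH _] _] := fP _ oHn HnK; split=> //.
  exact: subset_trans HH HnK.
have HsM i j : i <= j -> Hs j `<=` Hs i.
  move=> /subnK <-; elim: (j - i)%N => // n IHn; apply: subset_trans IHn.
  by have [oHn HnK] := HsP (n + i)%N; have [_ [+ _] _] := fP _ oHn HnK.
pose m := coset_index K U.
(* [K] meets only [m] cosets of [U], so the [m.+1] elements [a 0], ..., [a m] cannot lie in distinct
   ones; the last of them uses the step from [Hs m] to [Hs m.+1]. *)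
exists (Hs m.+1); split; [by case: (HsP m.+1)|exact: (HsM 0%N)|move=> g].
apply: contrapT => nex.
have UH a : U a -> conj_set g H a -> conj_set g (Hs m.+1) a.
  by move=> Ua Ha; apply: contrapT => nHa; apply: nex; exists a.
have /choice[a aP] : forall i, exists a, [/\ K a, conj_set g (Hs i) a
    & ~ conj_set g (Hs i.+1) a].
  move=> i; have [oHi HiK] := HsP i;
  have [_ _ /(_ g)[_ /existsNP[x]]] := fP _ oHi HiK.
  by move=> /not_implyP[[Kx Hx] nHx]; exists x; split=> // Hx'; apply: nHx.
have HsJ i j : i <= j -> conj_set g (Hs j) `<=` conj_set g (Hs i).
  by move=> ij; apply/conj_setS/HsM.
(* If [a i] and [a j] share a coset of [U], their quotient lies in [U] and in the conjugate of [H],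
   hence by [UH] in that of [Hs m.+1]. Since [a j] lies in the conjugate of [Hs i.+1], so does
   [a i], a contradiction. *)
have inj i j : i < j -> j <= m -> lcoset (a i) U <> lcoset (a j) U.
  move=> ij jm /lcoset_eq-/(_ sU) Uij.
  have [_ ai nai] := aP i; have [_ aj _] := aP j.
  have sHs k : is_subgroup (conj_set g (Hs k)).
    by apply: is_subgroup_conj; case: (HsP k) => -[].
  have Haij : conj_set g H ((a i)^-1 * a j).
    apply: (HsJ 0%N i (leq0n i)); apply: subgroupVM ai _ => //.
    exact: HsJ (ltnW ij) _ aj.
  have bij := HsJ _ _ (leq_trans ij (leqW jm)) _ (UH _ Uij Haij).
  have aj' := HsJ _ _ ij _ aj.
  apply: nai; rewrite (_ : a i = a j * ((a i)^-1 * a j)^-1).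
    by apply: subgroupM => //; apply: subgroupV.
  by rewrite invgM invgK mulgA mulgV mul1g.
pose s := [seq lcoset (a i) U | i <- iota 0 m.+1].
have : size s <= m.
  apply: uniq_leq_size.
    rewrite map_inj_in_uniq ?iota_uniq // => i j.
    rewrite !mem_iota /= !ltnS => im jm.
    by case: (ltngtP i j) => // [/inj/(_ jm)|/inj/(_ im) ne /esym].
  move=> C /mapP[i _ ->]; rewrite in_fset_set ?inE; last exact: finite_left_cosets.
  by exists (a i) => //; case: (aP i).
by rewrite size_map size_iota ltnn.
Qed.

(** Each class [c x] contributes its size times the common value of [phi] on it, and that size
    vanishes in [F]. *)
Lemma sum_classes_eq0 (F : fieldType) (V : lmodType F) (X : choiceType)
    (S : set X) (c : X -> set X) (phi : X -> V) :
  finite_set S -> (forall x, S x -> c x x) -> (forall x, S x -> c x `<=` S) ->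
  (forall x y, S x -> c x y -> c y = c x) ->
  (forall x y, S x -> c x y -> phi y = phi x) ->
  (forall x, S x -> (#|` fset_set (c x)|%:R = 0 :> F)%R) ->
  (\sum_(x \in S) phi x = 0)%R.
Proof.
(* The classes themselves, as sets, index the partition of [S]. *)
move=> fS cxx cS ceq cphi c0; rewrite fsbig_finite // (partition_big_imfset _ c) /=.
rewrite big_seq big1 // => j /imfsetP[x /= Sx ->].
move: Sx; rewrite in_fset_set // inE => Sx.
have fc : finite_set (c x) by apply: sub_finite_set fS; apply: cS.
rewrite big_fset_condE.
rewrite (_ : [fset _ | _ in _ & _]%fset = fset_set (c x)); last first.
  apply/fsetP => y; rewrite !inE /= !in_fset_set //; apply/andP/idP.
    by case=> /set_mem Sy /eqP <-; apply/mem_set/cxx.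
  by move=> /set_mem cy; split; [apply/mem_set/(cS x)|apply/eqP/ceq].
rewrite (eq_big_seq (fun=> phi x)) /=; last first.
  by move=> y; rewrite in_fset_set // inE; apply: cphi.
by rewrite big_const_seq iter_addr_0 count_predT -scaler_nat c0 // scale0r.
Qed.

(** * Free modules as spaces of finitely supported functions *)

Section PermutationModule.
Variables (F : fieldType) (X : choiceType) (D : set X).

Definition supp (f : X -> F^o) : set X := [set x | f x != 0%R].

Definition supported : {pred X -> F^o} := fun f =>
  `[< finite_set (supp f) /\ supp f `<=` D >].

Lemma supportedP f :
  reflect (finite_set (supp f) /\ supp f `<=` D) (f \in supported).
Proof. exact: asboolP. Qed.

Lemma supp_lin (a : F) (f g : X -> F^o) :
  supp (a *: f + g)%R `<=` supp f `|` supp g.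
Proof.
move=> x; rewrite /supp /=; have [fx|fx _] := eqVneq (f x) 0%R; last by left.
have [gx|gx _] := eqVneq (g x) 0%R; last by right.
suff -> : (a *: f + g)%R x = 0%R by rewrite eqxx.
by rewrite -[LHS]/(a * f x + g x)%R fx gx mulr0 addr0.
Qed.

Lemma supported_submod : GRing.submod_closed supported.
Proof.
split.
  apply/supportedP; rewrite (_ : supp _ = set0).
    by split=> //; exact: finite_set0.
  by apply/seteqP; split=> x //; rewrite /supp /= eqxx.
move=> a f g /supportedP[ff fD] /supportedP[gf gD]; apply/supportedP.
have sub := @supp_lin a f g; split.
  by apply: sub_finite_set sub _; rewrite finite_setU.
by move=> x /sub[/fD|/gD].
Qed.

HB.instance Definition _ :=
  GRing.isSubmodClosed.Build F (X -> F^o) supported supported_submod.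

(** The free module on [D], encoded by functions on the whole type [X] so that the module structure
    is inherited from [X -> F^o]. *)
Record permod := Permod { pval : X -> F^o ; pvalP : pval \in supported }.

HB.instance Definition _ := [isSub for pval].
HB.instance Definition _ := [Choice of permod by <:].
HB.instance Definition _ := [SubChoice_isSubLmodule of permod by <:].

Lemma supp_finite (f : permod) : finite_set (supp (pval f)).
Proof. by case/supportedP: (pvalP f). Qed.

Lemma supp_sub (f : permod) : supp (pval f) `<=` D.
Proof. by case/supportedP: (pvalP f). Qed.

End PermutationModule.

(** * Smooth permutation representations and their maps to [P] *)

Section PermutationRep.
Variables (F : fieldType) (G : topologicalGroupType) (X : choiceType).
Variables (D : set X) (act : G -> X -> X).
Hypothesis act1 : forall x, act 1 x = x.
Hypothesis actM : forall g h x, act (g * h) x = act g (act h x).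
Hypothesis actD : forall g x, D x -> D (act g x).
Hypothesis act_open : forall x, D x -> open (stabilizer act x).

Let V := permod F D.

Lemma actK g : cancel (act g) (act g^-1).
Proof. by move=> x; rewrite -actM mulVg act1. Qed.

Lemma actVK g : cancel (act g^-1) (act g).
Proof. by move=> x; rewrite -actM mulgV act1. Qed.

Lemma pact_supported g (f : V) :
  (fun x => pval f (act g^-1 x)) \in @supported F X D.
Proof.
apply/supportedP; split.
  apply: (@finite_preimage _ _ (supp (pval f)) (act g^-1)); last exact: supp_finite.
  by move=> x y _ _; apply: (can_inj (actVK g)).
by move=> x /supp_sub/(@actD g); rewrite actVK.
Qed.

(** The inverse taken in the argument makes this a left action that moves the basis vector at [x] to
    the one at [act g x]. *)
Definition pact g (f : V) : V := Permod (pact_supported g f).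

Lemma pact_linear g : linear (pact g).
Proof. by move=> a u v; apply/val_inj. Qed.

HB.instance Definition _ g :=
  GRing.isLinear.Build F V V *:%R (pact g) (pact_linear g).

Lemma pact1 f : pact 1 f = f.
Proof. by apply/val_inj/funext => x /=; rewrite invg1 act1. Qed.

Lemma pactM g h f : pact (g * h) f = pact g (pact h f).
Proof. by apply/val_inj/funext => x /=; rewrite invgM actM. Qed.

(** The pointwise stabilizer [N] of the finite support is open and fixes [f], so the stabilizer of
    [f] is a union of cosets of [N]. *)
Lemma pact_open f : open [set g | pact g f = f].
Proof.
pose N := \bigcap_(x in supp (pval f)) stabilizer act x.
have sN : is_subgroup N.
  apply: is_subgroup_VM; first by move=> x _; apply: act1.
  move=> g h Ng Nh x fx.
  exact: (subgroupVM (is_subgroup_stabilizer act1 actM x) (Ng x fx) (Nh x fx)).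
have oN : open N.
  by apply: open_finite_bigcap;
    [apply: supp_finite|move=> x /supp_sub; apply: act_open].
apply: (@open_rstable _ N _ (conj sN oN)) => g n; rewrite /= pactM => gf Nn.
suff -> : pact n f = f by [].
apply/val_inj/funext => x /=.
have NV : N n^-1 := subgroupV sN Nn.
have [fx|fx] := eqVneq (pval f x) 0%R; last by rewrite (NV x).
(* If [act n^-1 x] were in the support, [n] would fix it, so it would equal [x], where [f]
   vanishes. *)
rewrite fx; have [//|fy] := eqVneq (pval f (act n^-1 x)) 0%R.
have := Nn _ fy; rewrite /stabilizer /= actVK => xy.
by move: fy; rewrite /= -xy fx eqxx.
Qed.

Definition perm_rep : smooth_rep F G :=
  SmoothRep (rep_act := fun g => pact g : {linear V -> V}) pact1 pactM pact_open.

Variables (P : smooth_rep F G) (pi : X -> P).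
Hypothesis piE : forall g x, D x -> pi (act g x) = rep_act P g (pi x).

(** The linear extension of [pi] from basis points; only the finite support of [f] contributes to
    the sum. *)
Definition psum (f : V) : P := (\sum_(x \in [set: X]) pval f x *: pi x)%R.

Lemma psumE (S : set X) (f : V) : supp (pval f) `<=` S ->
  psum f = (\sum_(x \in S) pval f x *: pi x)%R.
Proof.
move=> fS; apply/esym/fsbig_widen => // x [_ nSx] /=.
have [->|/fS//] := eqVneq (pval f x) 0%R; exact: scale0r.
Qed.

Lemma psum_linear : linear psum.
Proof.
move=> a f g; pose S := supp (pval f) `|` supp (pval g).
have fS : finite_set S by rewrite finite_setU; split; apply: supp_finite.
rewrite !(@psumE S); first last.
- exact: supp_lin.
- by move=> x; left.
- by move=> x; right.
rewrite !fsbig_finite // scaler_sumr -big_split /=; apply: eq_bigr => x _.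
by rewrite scalerA -scalerDl.
Qed.

HB.instance Definition _ := GRing.isLinear.Build F V P *:%R psum psum_linear.

Lemma psum_equivariant g (f : V) : psum (pact g f) = rep_act P g (psum f).
Proof.
rewrite [LHS](@reindex_fsbigT _ _ _ _ _ (act g)); last first.
  by exists (act g^-1); [apply: actK|apply: actVK].
rewrite (@psumE (supp (pval f)) f) // [X in rep_act P g X]fsbig_finite;
  last exact: supp_finite.
rewrite linear_sum /= -fsbig_finite; last exact: supp_finite.
rewrite (@fsbig_widen _ _ _ _ _ setT) //; last first.
  move=> x [_ /= /negP]; rewrite negbK => /eqP ->.
  by rewrite scale0r linear0.
apply: eq_fsbigr => x _; rewrite /= actK linearZ /=.
(* [piE] speaks of points of [D] only, and every nonzero coefficient sits at such a point. *)
have [->|/supp_sub fx] := eqVneq (pval f x) 0%R; first by rewrite !scale0r.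
by rewrite piE.
Qed.

Definition psum_hom : rep_hom perm_rep P :=
  @RepHom F G perm_rep P psum psum_equivariant.

(** The classes are the orbits of [A x], the stabilizer of [pi x] in [U]: on such an orbit [f] is
    constant because [U] fixes it, and [pi] because [A x] fixes [pi x]. *)
Lemma psum_invariant (U : set G) (f : V) : is_subgroup U ->
  (forall a, U a -> pact a f = f) ->
  (forall x, D x ->
    (#|` fset_set [set act a x | a in U `&` stabilizer (rep_act P) (pi x)]|%:R
      = 0 :> F)%R) ->
  psum f = 0%R.
Proof.
move=> sU Uf c0; pose A x := U `&` stabilizer (rep_act P) (pi x).
have sA x : is_subgroup (A x).
  by apply/is_subgroupI/is_subgroup_stabilizer => //;
    [exact: rep_act1|exact: rep_actM].
have fE a x : U a -> pval f (act a x) = pval f x.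
  by move=> Ua; rewrite -{1}(Uf a Ua) /= actK.
rewrite (@psumE (supp (pval f)) f) //.
apply: (@sum_classes_eq0 F _ _ _ (fun x => [set act a x | a in A x])).
- exact: supp_finite.
- by move=> x _; exists 1; [exact: subgroup1|exact: act1].
- by move=> x fx _ [a [Ua _] <-]; rewrite /supp /= fE.
- move=> x _ /supp_sub Dx [a Aa <-].
  (* As [pi] is constant along a class, all its points have the same group, and the class is an
     orbit of that group seen from any of them. *)
  have AE : A (act a x) = A x by rewrite /A piE //; case: Aa => _ ->.
  rewrite AE; apply/seteqP; split=> _ [b Ab <-].
    by exists (b * a); [exact: subgroupM|exact: actM].
  exists (b * a^-1); first by apply: subgroupM => //; apply: subgroupV.
  by rewrite actM actK.
- move=> x _ /supp_sub Dx [a [Ua ax] <-].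
  by rewrite piE // ax fE.
- by move=> x /supp_sub; apply: c0.
Qed.

End PermutationRep.

(** * Covering a representation by a sum of coset modules *)

Section CosetCover.
Variables (F : fieldType) (G : topologicalGroupType) (P : smooth_rep F G).
Variable H : P -> set G.
Hypothesis oH : forall w, open_subgroup (H w).
Hypothesis HP : forall w, H w `<=` stabilizer (rep_act P) w.

(* Only the points (w, g H_w) of X matter: they form [coset_points], the
   disjoint union of the coset spaces G/H_w. *)
Let X : choiceType := (P * set G)%type.

Definition coset_act g (x : X) : X := (x.1, lcoset g x.2).

Definition coset_points : set X := [set x | exists g, x.2 = lcoset g (H x.1)].

(** At a point [(w, g H_w)] the result is [g w] whichever element of the coset is chosen, because
    [H w] fixes [w]; the default [1] serves only an empty second component. *)
Definition coset_vector (x : X) : P := rep_act P (xget 1 x.2) x.1.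

Lemma coset_act1 x : coset_act 1 x = x.
Proof. by case: x => w C; rewrite /coset_act lcoset1. Qed.

Lemma coset_actM g h x : coset_act (g * h) x = coset_act g (coset_act h x).
Proof. by rewrite /coset_act lcosetM. Qed.

Lemma coset_actD g x : coset_points x -> coset_points (coset_act g x).
Proof. by case=> h hx; exists (g * h); rewrite /= hx lcosetM. Qed.

Lemma stabilizer_coset w g :
  stabilizer coset_act (w, lcoset g (H w)) = conj_set g (H w).
Proof.
have [sH _] := oH w; rewrite conj_setE; apply/seteqP; split=> a.
  rewrite /stabilizer /coset_act /= -lcosetM => -[/esym/lcoset_eq].
  by rewrite mulgA; apply.
rewrite /stabilizer /coset_act /= -lcosetM => Ha.
by congr (_, _); apply/esym/lcoset_eq; rewrite ?mulgA.
Qed.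

Lemma coset_act_open x : coset_points x -> open (stabilizer coset_act x).
Proof.
case: x => w C [g /= ->]; rewrite stabilizer_coset.
by apply: open_conj; case: (oH w).
Qed.

Lemma coset_vectorE w g : coset_vector (w, lcoset g (H w)) = rep_act P g w.
Proof.
rewrite /coset_vector /=; case: xgetP => [b _ /lcosetP/HP gb|/(_ g)]; last first.
  by case; apply: lcoset_refl; case: (oH w).
by rewrite -{2}gb -rep_actM mulgA mulgV mul1g.
Qed.

Lemma coset_vector_act g x :
  coset_points x -> coset_vector (coset_act g x) = rep_act P g (coset_vector x).
Proof.
case: x => w C [h /= ->]; rewrite /coset_act /= -lcosetM.
by rewrite !coset_vectorE rep_actM.
Qed.

Definition coset_rep : smooth_rep F G :=
  perm_rep F coset_act1 coset_actM (@coset_actD) coset_act_open.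

Definition coset_cover : rep_hom coset_rep P :=
  psum_hom coset_act1 coset_actM coset_actD coset_act_open coset_vector_act.

(** The point mass at the coset [H w] itself is sent to [w]. *)
Lemma coset_cover_surj w : exists f, coset_cover f = w.
Proof.
pose x : X := (w, H w); pose d (y : X) : F^o := if y == x then 1%R else 0%R.
have sub : supp d `<=` [set x].
  by move=> y; rewrite /supp /d /=; have [-> //|_] := eqVneq y x; rewrite eqxx.
have dP : d \in supported coset_points.
  apply/supportedP; split; first exact: sub_finite_set sub (finite_set1 _).
  by move=> y /sub ->; exists 1; rewrite lcoset1.
exists (Permod dP); rewrite /= (@psumE _ _ _ _ _ _ [set x]) //.
by rewrite fsbig_set1 /= /d eqxx scale1r /x -[H w]lcoset1 coset_vectorE rep_act1.
Qed.

Lemma coset_cover_epi : epimorphism coset_cover.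
Proof. by move=> Y h1 h2 e w; have [f <-] := coset_cover_surj w; apply: e. Qed.

End CosetCover.

(** * Splitting of covers of projectives, and vanishing of every vector *)

Lemma projective_split (F : fieldType) (G : topologicalGroupType)
    (V P : smooth_rep F G) (e : rep_hom V P) :
  projective P -> epimorphism e -> exists h : rep_hom P V, forall v, e (h v) = v.
Proof.
move=> projP epi.
have idE g v : (idfun : {linear P -> P}) (rep_act P g v) =
    rep_act P g ((idfun : {linear P -> P}) v).
  by [].
by have [h hE] := projP V P e (RepHom idE) epi; exists h => v; apply: hE.
Qed.

Local Open Scope ring_scope.

Theorem theorem1p2 (F : fieldType) (p : nat) (hp : p \in [pchar F])
    (G : topologicalGroupType) (hG : locally_pro_p p G)
    (hK : exists K : set G, [/\ open_subgroup K, profinite K & fair K]) :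
  ~ (exists P : smooth_rep F G, projective P /\ nonzero P).
Proof.
move=> [P [projP [v v0]]]; apply: v0.
have pp := pcharf_prime hp.
have [U0 [oU0 pU0]] := hG; have [K [oK [sK cK _ _] fK]] := hK.
have oS (w : P) : open_subgroup (stabilizer (rep_act P) w).
  split; last exact: rep_smooth.
  by apply: is_subgroup_stabilizer; [apply: rep_act1|apply: rep_actM].
(* The intersection with [K] brings the stabilizer inside [K], as [fair_inside] requires. *)
pose S (w : P) := stabilizer (rep_act P) w `&` K.
(* [U] depends on [v] alone, so the subgroups [H w], and with them the cover, can be chosen in terms
   of it. *)
pose U := stabilizer (rep_act P) v `&` U0.
have oU : open_subgroup U by apply: open_subgroupI.
have [sU _] := oU.
have /choice[H HP] : forall w : P, exists H', [/\ open_subgroup H', H' `<=` S w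
    & forall g, exists a, [/\ U a, conj_set g (S w) a & ~ conj_set g H' a]].
  move=> w; apply: (fair_inside sK cK fK oU); first exact: open_subgroupI.
  by move=> x [].
have oH (w : P) : open_subgroup (H w) by case: (HP w).
have HS (w : P) : H w `<=` stabilizer (rep_act P) w.
  by case: (HP w) => _ + _ => /subset_trans; apply=> x [].
have [h hE] := projective_split projP (@coset_cover_epi F G P H oH HS).
(* The lift [h v] is fixed by [U] since [h] is equivariant, so it suffices that the size of each
   class vanishes in [F]. *)
rewrite -(hE v).
apply: (@psum_invariant F G _ _ _ (@coset_act1 F G P) (@coset_actM F G P)
  (@coset_actD F G P H) P _ (coset_vector_act oH HS) U (h v) sU).
  by move=> a [av _]; rewrite -[LHS](rep_hom_equivariant h a v) av.
case=> w C [g /= ->]; rewrite coset_vectorE //.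
(* [A] is the stabilizer of [g w] in [U], and [B] that of the point [(w, g H_w)] in [A]; the class
   has as many points as [B] has cosets in [A]. *)
set A := U `&` _; pose B := A `&` conj_set g (H w).
have oA : open_subgroup A by apply: open_subgroupI.
have oB : open_subgroup B by apply: open_subgroupI => //; apply: open_subgroup_conj.
have [_ _ /(_ g)[a [Ua Sa nHa]]] := HP w.
(* The conjugate of [S w] by [g] stabilizes [g w], so the element supplied by fairness lies in
   [A]. *)
have Aa : A a.
  split=> //.
  rewrite (@stabilizer_act G P (rep_act P) (@rep_act1 F G P) (@rep_actM F G P)).
  by apply: conj_setS Sa => x [].
have nBa : ~ B a by case.
have AU0 : A `<=` U0 by move=> x [[]].
have BA : B `<=` A by move=> x [].
have [sA _] := oA.
have [fin pdvd] := pro_p_index pp pU0 sA AU0 oB BA Aa nBa.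
have := @orbit_cosets G _ _ (@coset_act1 F G P) (@coset_actM F G P) A
  (w, lcoset g (H w)) sA.
rewrite (stabilizer_coset oH) => /(_ fin)[_ ->].
by apply/eqP; rewrite -(dvdn_pcharf hp).
Qed.
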